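(* Consider the quality-equivalent regime: for some $s_0\in\mathbb R_{\ge0}$, $\mathbb P[s_i=s_0]=1$ for every $i\in\mathcal N$, with additive utility. For any common pricing $p$ there exists a common pricing without bonus $p'$, i.e. $p'(s_i)=\nu$ for some constant $\nu\in\mathbb R_{\ge0}$, such that $U(B;p)=U(B;p')$.
   Context: Workers: $\mathcal N=\{1,\dots,n\}$. Worker $i$ has a random private profile $(s_i,c_i)\in\mathbb R_{\ge0}^2$ (quality, cost). Pricing: a common pricing is given by a single increasing (not necessarily strictly; constants are allowed) function $p:\mathbb R_{\ge0}\to\mathbb R_{\ge0}$, offered to all workers; worker $i$, if recruited, is paid $p(s_i)$. It is without bonus if $p$ is a constant function. Allocation process: given $p$, a budget $B\ge0$ and a fixed ordering $\sigma$ of $\mathcal N$, workers arrive in the order $\sigma$. When worker $i$ arrives: if the remaining budget is smaller than worker $i$'s maximal possible reward (the largest possible value of $p(s_i)$, over the support of $s_i$), she is discarded ($x_i=0$); otherwise she accepts iff $p(s_i)\ge c_i$; if she accepts, $x_i=1$ and $p(s_i)$ is deducted from the remaining budget; otherwise $x_i=0$. The law of the resulting $\vec x\in\{0,1\}^n$ (random through the profiles) is denoted $\mathcal P(p,B,\sigma)$. Utility: $u(\vec s\circ\vec x)=\sum_{i\in\mathcal N}s_ix_i$ (additive), and $U(B;p):=\mathbb E_{\vec x\sim\mathcal P(p,B,\sigma)}[u(\vec s\circ\vec x)]$. *)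

(* Defs.v *)
From HB Require Import structures.
From mathcomp Require Import all_boot all_order all_algebra all_fingroup.
From mathcomp Require Import all_classical all_reals all_analysis.
Set Implicit Arguments.
Unset Strict Implicit.
Unset Printing Implicit Defensive.
Import Order.TTheory GRing.Theory Num.Theory.
Import numFieldNormedType.Exports.
Local Open Scope classical_set_scope.
Local Open Scope ring_scope.

(* A pricing is a map R_{>=0} -> R_{>=0}; it is represented by a function on R
   whose values at negative arguments are irrelevant. *)
Definition common_pricing (R : realType) (p : R -> R) : Prop :=
  (forall t : R, 0 <= t -> 0 <= p t) /\
  (forall t t' : R, 0 <= t -> t <= t' -> p t <= p t').

Definition without_bonus (R : realType) (p : R -> R) : Prop :=
  exists2 nu : R, 0 <= nu & forall t : R, 0 <= t -> p t = nu.

Definition support_of d (T : measurableType d) (R : realType)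
    (P : probability T R) (X : {RV P >-> R}) : set R :=
  [set t | forall V : set R, open V -> V t -> (0 < distribution P X V)%E].

(* The supremum is taken in the extended reals: it is +oo when p is unbounded
   on the support, and then no finite budget suffices. *)
Definition max_reward d (T : measurableType d) (R : realType)
    (P : probability T R) (p : R -> R) (X : {RV P >-> R}) : \bar R :=
  ereal_sup [set (p t)%:E | t in support_of X].

(* The workers recruited from the arrival sequence ws with remaining budget b,
   for realised qualities s and costs c; m i is the maximal reward of i. *)
Fixpoint recruited (R : realType) (n : nat) (p : R -> R) (m : 'I_n -> \bar R)
    (s c : 'I_n -> R) (b : R) (ws : seq 'I_n) : seq 'I_n :=
  if ws is i :: ws' then
    if (b%:E < m i)%E then recruited p m s c b ws'
    else if c i <= p (s i) then i :: recruited p m s c (b - p (s i)) ws'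
    else recruited p m s c b ws'
  else [::].

(* sigma k is the worker arriving in position k. *)
Definition allocation d (T : measurableType d) (R : realType)
    (P : probability T R) (n : nat) (s c : 'I_n -> {RV P >-> R})
    (sigma : 'S_n) (B : R) (p : R -> R) (w : T) (i : 'I_n) : bool :=
  i \in recruited p (fun j => max_reward p (s j))
          (fun j => s j w) (fun j => c j w) B [seq sigma k | k <- enum 'I_n].

Definition additive_utility (R : realType) (n : nat) (v : 'I_n -> R) : R :=
  \sum_(i < n) v i.

Definition expected_utility d (T : measurableType d) (R : realType)
    (P : probability T R) (n : nat) (s c : 'I_n -> {RV P >-> R})
    (sigma : 'S_n) (B : R) (p : R -> R) : \bar R :=
  'E_P[fun w => additive_utility
         (fun i => s i w * (allocation s c sigma B p w i)%:R)].

(* Main.v *)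
Require Import Defs.
From HB Require Import structures.
From mathcomp Require Import all_boot all_order all_algebra all_fingroup.
From mathcomp Require Import all_classical all_reals all_analysis.
From mathcomp Require Import measurable_realfun.
Set Implicit Arguments.
Unset Strict Implicit.
Unset Printing Implicit Defensive.
Import Order.TTheory GRing.Theory Num.Theory.
Import numFieldNormedType.Exports.
Local Open Scope classical_set_scope.
Local Open Scope ring_scope.

Section ge0_ae_le_integral.
Import HBNNSimple.

(* Unlike [ae_eq_integral] and [ge0_le_integral], no measurability is required:
   the integral of a nonnegative function is a supremum over the simple
   functions below it, and these can be cut off on the exceptional null set. *)
Lemma ge0_ae_le_integralT d (T : measurableType d) (R : realType)
    (mu : {measure set T -> \bar R}) (f g : T -> \bar R) :
  (forall x, 0 <= f x)%E -> (forall x, 0 <= g x)%E ->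
  {ae mu, forall x, (f x <= g x)%E} ->
  (\int[mu]_x f x <= \int[mu]_x g x)%E.
Proof.
move=> f_ge0 g_ge0 [N [mN muN0 subN]].
rewrite (ge0_integralTE _ f_ge0) (ge0_integralTE _ g_ge0).
apply: ge_ereal_sup => _ [h /= h_le_f <-].
pose h' := proj_nnsfun h (measurableC mN).
have h'E x : h' x = h x * \1_(~` N) x by [].
have -> : sintegral mu h = sintegral mu h'.
  rewrite -!integralT_nnsfun; apply: ae_eq_integral => //.
  - exact/measurable_EFinP/measurable_funPT.
  - exact/measurable_EFinP/measurable_funPT.
  - exists N; split => // x; apply: contra_notP => Nx _.
    by rewrite h'E indicE mem_set// mulr1.
apply: ereal_sup_ubound; exists h' => // x.
(* On [N] the function [h'] vanishes and nonnegativity of [g] suffices; off [N] it agrees with [h],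
   which lies below [f] and hence below [g]. *)
rewrite h'E indicE; have [Nx|Nx] := pselect (N x).
  by rewrite memNset ?mulr0//= => /(_ Nx).
rewrite mem_set// mulr1; apply: le_trans (h_le_f x) _.
by apply: contrapT => /subN.
Qed.

End ge0_ae_le_integral.

(** Being free of measurability, it lets expected utilities be compared without showing that the
    realised allocation depends measurably on the outcome. *)
Lemma ge0_ae_eq_integralT d (T : measurableType d) (R : realType)
    (mu : {measure set T -> \bar R}) (f g : T -> \bar R) :
  (forall x, 0 <= f x)%E -> (forall x, 0 <= g x)%E ->
  {ae mu, forall x, f x = g x} ->
  (\int[mu]_x f x = \int[mu]_x g x)%E.
Proof.
move=> f_ge0 g_ge0 fg; apply/eqP; rewrite eq_le; apply/andP.
by split; apply: ge0_ae_le_integralT => //; apply: filterS fg => x ->.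
Qed.

(** The complement of [[set a]] is open and has mass zero, which excludes every other point; an open
    set around [a] has a preimage containing an event of mass one. *)
Lemma support_of_ae_cst d (T : measurableType d) (R : realType)
    (P : probability T R) (X : {RV P >-> R}) (a : R) :
  P [set w | X w = a] = 1%E -> support_of X = [set a].
Proof.
move=> Xa; have mXa : measurable [set w | X w = a].
  exact: (measurable_funPTI X (measurable_set1 a)).
apply/seteqP; split=> [t tX|_ ->] /=.
  apply: contrapT => t_neq_a.
  have := tX (~` [set a]) (closed_openC (@closed_eq R a)) t_neq_a.
  rewrite /distribution /pushforward -preimage_setC probability_setC//.
  by rewrite Xa subee// ltxx.
move=> V oV Va; apply: lt_le_trans (_ : P [set w | X w = a] <= _)%E.
  by rewrite Xa lte01.
apply: le_measure; rewrite ?inE//.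
  by apply: measurable_funPTI; exact: open_measurable.
by move=> w /= ->.
Qed.

Lemma max_reward_ae_cst d (T : measurableType d) (R : realType)
    (P : probability T R) (p : R -> R) (X : {RV P >-> R}) (a : R) :
  P [set w | X w = a] = 1%E -> max_reward p X = (p a)%:E.
Proof.
by move=> Xa; rewrite /max_reward (support_of_ae_cst Xa) image_set1 ereal_sup1.
Qed.

Lemma ae_of_probability1 d (T : measurableType d) (R : realType)
    (P : probability T R) (A : set T) :
  measurable A -> P A = 1%E -> {ae P, forall w, A w}.
Proof.
move=> mA PA; exists (~` A); split=> //; first exact: measurableC.
by rewrite probability_setC// PA subee.
Qed.

(** The process consults the pricing only at realised qualities and through the maximal rewards. The
    induction is over all budgets, since a recruitment lowers the remaining one. *)
Lemma eq_recruited (R : realType) (n : nat) (p q : R -> R)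
    (m m' : 'I_n -> \bar R) (s c : 'I_n -> R) (b : R) (ws : seq 'I_n) :
  m =1 m' -> (forall i, p (s i) = q (s i)) ->
  recruited p m s c b ws = recruited q m' s c b ws.
Proof.
move=> mm' pq; elim: ws b => //= i ws IHws b.
by rewrite mm' pq !IHws.
Qed.

Theorem proposition3 (R : realType) (d : measure_display)
  (T : measurableType d) (P : probability T R) (n : nat)
  (s c : 'I_n -> {RV P >-> R})
  (s_ge0 : forall (i : 'I_n) (w : T), 0 <= s i w)
  (c_ge0 : forall (i : 'I_n) (w : T), 0 <= c i w)
  (s0 : R) (s0_ge0 : 0 <= s0)
  (quality_equivalent : forall i : 'I_n, P [set w | s i w = s0] = 1%E)
  (sigma : 'S_n) (B : R) (B_ge0 : 0 <= B)
  (p : R -> R) (p_pricing : common_pricing p) :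
  exists p' : R -> R,
    [/\ common_pricing p', without_bonus p' &
        expected_utility s c sigma B p = expected_utility s c sigma B p'].
Proof.
have ps0_ge0 : 0 <= p s0 by case: p_pricing => + _; apply.
(* The constant is the price that [p] almost surely offers to every worker. *)
exists (fun=> p s0); split=> //; first by exists (p s0).
rewrite /expected_utility unlock.
apply: ge0_ae_eq_integralT => [w|w|]; first 2 last.
- have ae_s0 : {ae P, forall w, forall i, s i w = s0}.
    (* There are finitely many workers, so a single null set serves all of them. *)
    apply: filter_forall => i.
    apply: ae_of_probability1 (quality_equivalent i).
    exact: (measurable_funPTI (s i) (measurable_set1 s0)).
  apply: filterS ae_s0 => w sw; congr EFin; apply: eq_bigr => i _.
  congr (_ * (_ \in _)%:R); apply: eq_recruited => j; last by rewrite sw.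
  (* The discard test is also unchanged: each support is [[set s0]], so under both pricings the
     maximal reward is [p s0], whatever values [p] takes elsewhere. *)
  by rewrite !(max_reward_ae_cst _ (quality_equivalent j)).
- by rewrite lee_fin; apply: sumr_ge0 => i _; rewrite mulr_ge0.
- by rewrite lee_fin; apply: sumr_ge0 => i _; rewrite mulr_ge0.
Qed.
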